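(* Let $\mu:\mathbb{R}^d\to(0,\infty)$ be continuously differentiable, $M\in\mathbb{R}^{d\times d}$ symmetric positive definite, and $h>0$. Let $\mathbb{A}$ be the augmented space with reference measure $\zeta$, and let $\Psi:\mathbb{A}\to\mathbb{A}$ be $$\Psi(\theta,\rho,m,b,\boldsymbol{\ell},i)=\big(\Phi_{i,0}|_{\boldsymbol{\ell}}(\theta,\rho),\,m,\,b-i,\,\mathcal{S}^i\boldsymbol{\ell},\,-i\big),$$ with all objects as defined in the context. Then $\Psi$ is an involution on $\mathbb{A}$ (that is, $\Psi\circ\Psi=\mathrm{id}$) that preserves $\zeta$.
   Context: Notation: $\mathbb{N}=\{0,1,2,\dots\}$ and $a{:}b=\{a,a+1,\dots,b\}$ for integers $a\le b$. Momentum flip: $\mathcal{F}(\theta,\rho)=(\theta,-\rho)$ on $\mathbb{R}^{2d}$. Leapfrog map with step size $s>0$: $\Phi_s(\theta,\rho)=(\theta',\rho')$ with $\theta'=\theta+M^{-1}\big(s\rho+\frac{s^2}{2}\nabla\log\mu(\theta)\big)$ and $\rho'=\rho+\frac s2\big(\nabla\log\mu(\theta)+\nabla\log\mu(\theta')\big)$. $\Phi_s^n$ is its $n$-fold composition. Augmented space: $\mathbb{A}$ is the set of tuples $z=(\theta,\rho,m,b,\boldsymbol{\ell},i)$ with $\theta,\rho\in\mathbb{R}^d$, $m\in\mathbb{N}$, $b\in0{:}(2^m-1)$, and, with $a:=b-2^m+1$, $\boldsymbol{\ell}=(\ell_j)_{a\le j\le b-1}$ a family of $2^m-1$ positive integers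 and $i\in a{:}b$. The reference measure $\zeta$ on $\mathbb{A}$ is the product of Lebesgue measure in $(\theta,\rho)\in\mathbb{R}^{2d}$ and counting measure in the discrete components $(m,b,\boldsymbol{\ell},i)$. Variable step size evolution: $\Phi_{0,0}|_{\boldsymbol{\ell}}=\mathrm{id}$; for $j>0$, $\Phi_{j,0}|_{\boldsymbol{\ell}}=\Phi_{h/\ell_{j-1}}^{\ell_{j-1}}\circ\cdots\circ\Phi_{h/\ell_0}^{\ell_0}$; for $j<0$, $\Phi_{j,0}|_{\boldsymbol{\ell}}=\mathcal{F}\circ\Phi_{h/\ell_j}^{\ell_j}\circ\cdots\circ\Phi_{h/\ell_{-1}}^{\ell_{-1}}\circ\mathcal{F}$. Shift: for $i\in a{:}b$, $\mathcal{S}^i\boldsymbol{\ell}$ is the family indexed by $a-i\le j\le b-i-1$ with $(\mathcal{S}^i\boldsymbol{\ell})_j=\ell_{j+i}$. *)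

(* Defs.v *)
From HB Require Import structures.
From mathcomp Require Import all_boot all_order all_algebra finmap.
From mathcomp Require Import zify.
From mathcomp Require Import all_classical all_reals all_analysis.
Set Implicit Arguments.
Unset Strict Implicit.
Unset Printing Implicit Defensive.
Import Order.TTheory GRing.Theory Num.Theory.
Import numFieldNormedType.Exports.
Local Open Scope classical_set_scope.
Local Open Scope ring_scope.

(* The Borel sigma-algebra on matrices, hence on R^d = 'cV[R]_d. *)
HB.instance Definition _ (R : realType) (m n : nat) :=
  Measurable.copy 'M[R]_(m, n)
    (g_sigma_algebraType (@open 'M[R]_(m, n))).

(* Lebesgue measure on R^n: the n-fold product of the one-dimensional one,
   carried to column vectors by (x, v) |-> (x, v_0, ..., v_(n-1))^T. *)
Fixpoint lebesgue_cV (R : realType) (n : nat) : set 'cV[R]_n -> \bar R :=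
  match n with
  | 0%N => dirac (0 : 'cV[R]_0)
  | n'.+1 =>
      pushforward (product_measure1 (@lebesgue_measure R) (@lebesgue_cV R n'))
        (fun p : measurableTypeR R * 'cV[R]_n' =>
           col_mx (p.1)%:M p.2 : 'cV[R]_(n'.+1))
  end.

Section Leapfrog.
Context {R : realType} {d : nat}.
Implicit Types (mu f : 'cV[R]_d -> R) (M : 'M[R]_d) (z : 'cV[R]_d * 'cV[R]_d).

Definition gradient f (x : 'cV[R]_d) : 'cV[R]_d :=
  \col_i 'D_(delta_mx i 0) f x.

Definition continuously_differentiable f : Prop :=
  (forall x, differentiable f x) /\ continuous (gradient f).

Definition positive_definite M : Prop :=
  forall x : 'cV[R]_d, x != 0 -> 0 < (x^T *m M *m x) 0 0.

Definition momentum_flip z := (z.1, - z.2).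

Definition leapfrog mu M (s : R) z :=
  let grad_log := gradient (fun x => ln (mu x)) in
  let theta' := z.1 + invmx M *m (s *: z.2 + (s ^+ 2 / 2) *: grad_log z.1) in
  let rho' := z.2 + (s / 2) *: (grad_log z.1 + grad_log theta') in
  (theta', rho').

(* n leapfrog steps of size h / n *)
Definition substeps mu M (h : R) (n : nat) :=
  iter n (leapfrog mu M (h / n%:R)).

Fixpoint forward_evolution mu M (h : R) (l : int -> nat) (n : nat) z :=
  if n is k.+1 then
    substeps mu M h (l k%:Z) (forward_evolution mu M h l k z)
  else z.

Fixpoint backward_evolution mu M (h : R) (l : int -> nat) (n : nat) z :=
  if n is k.+1 then
    substeps mu M h (l (- k.+1%:Z)) (backward_evolution mu M h l k z)
  else z.

(* [Negz n] is the integer - n.+1 *)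
Definition evolution mu M (h : R) (l : int -> nat) (j : int) z :=
  match j with
  | Posz n => forward_evolution mu M h l n z
  | Negz n =>
      momentum_flip (backward_evolution mu M h l n.+1 (momentum_flip z))
  end.

End Leapfrog.

(* A finite family of positive integers indexed by integers is represented by
   its extension by 0 to all of int, so that its index set is its support. *)
Definition substep_family : Type := {fsfun int -> nat with 0%N}.

HB.instance Definition _ := Countable.on substep_family.

Definition first_index (m : nat) (b : int) : int := b - (2 ^ m)%N%:Z + 1.

Definition is_discrete_part (k : nat * int * substep_family * int) : bool :=
  let: (m, b, l, i) := k in
  let a := first_index m b in
  [&& 0 <= b <= (2 ^ m)%N%:Z - 1,
      `[< forall j : int, (0 < l j)%N = (a <= j <= b - 1) >] &
      a <= i <= b].

Record discrete_part := DiscretePart {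
  discrete_val :> nat * int * substep_family * int;
  discrete_valP : is_discrete_part discrete_val }.

HB.instance Definition _ := [isSub for discrete_val].
HB.instance Definition _ := [Countable of discrete_part by <:].

Definition discrete_m (k : discrete_part) : nat := k.1.1.1.
Definition discrete_b (k : discrete_part) : int := k.1.1.2.
Definition discrete_l (k : discrete_part) : substep_family := k.1.2.
Definition discrete_i (k : discrete_part) : int := k.2.

Fact is_discrete_part0 : is_discrete_part (0%N, 0, [fsfun for fun=> 0%N], 0).
Proof.
by apply/and3P; split=> //; apply/asboolP => j;
  rewrite fsfun0E /first_index; lia.
Qed.

HB.instance Definition _ :=
  isPointed.Build discrete_part (DiscretePart is_discrete_part0).

HB.instance Definition _ := @isMeasurable.Build default_measure_display
  discrete_part discrete_measurable discrete_measurable0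
  discrete_measurableC discrete_measurableU.

Definition shift_family (i : int) (l : substep_family) : substep_family :=
  [fsfun j in [fset k - i | k in finsupp l]%fset => l (j + i) | 0%N].

Lemma shift_familyE i l j : shift_family i l j = l (j + i).
Proof.
rewrite fsfun_fun; case: ifPn => // /negP jN.
rewrite fsfun_dflt //; apply/negP => jl; apply: jN.
by apply/imfsetP; exists (j + i) => //; rewrite addrK.
Qed.

Fact is_discrete_part_map (k : discrete_part) :
  is_discrete_part (discrete_m k, discrete_b k - discrete_i k,
                    shift_family (discrete_i k) (discrete_l k),
                    - discrete_i k).
Proof.
rewrite /discrete_m /discrete_b /discrete_l /discrete_i.
have := discrete_valP k.
case: (discrete_val k) => [[[m b] l] i] /= /and3P[bP /asboolP lP iP].
rewrite /is_discrete_part /first_index in lP iP *.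
apply/and3P; split; [lia| |lia].
by apply/asboolP => j; rewrite shift_familyE lP; lia.
Qed.

Definition discrete_map (k : discrete_part) : discrete_part :=
  DiscretePart (is_discrete_part_map k).

(* The tuple (theta, rho, m, b, l, i) is ((theta, rho), (m, b, l, i)). *)
Definition augmented (R : realType) (d : nat) : Type :=
  ('cV[R]_d * 'cV[R]_d) * discrete_part.

HB.instance Definition _ (R : realType) (d : nat) :=
  Measurable.on (augmented R d).

(* [product_measure2] integrates the R^(2d)-measure of the section at each
   discrete part against counting measure, i.e. sums it over all of them. *)
Definition zeta (R : realType) (d : nat) : set (augmented R d) -> \bar R :=
  product_measure2
    (product_measure1 (@lebesgue_cV R d) (@lebesgue_cV R d))
    (@counting discrete_part R).

Definition Psi (R : realType) (d : nat) (mu : 'cV[R]_d -> R) (M : 'M[R]_d)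
    (h : R) (z : augmented R d) : augmented R d :=
  (evolution mu M h (discrete_l z.2) (discrete_i z.2) z.1, discrete_map z.2).

Definition measure_preserving (disp : measure_display)
    (T : measurableType disp) (R : realType) (nu : set T -> \bar R)
    (f : T -> T) : Prop :=
  measurable_fun setT f /\
  forall A : set T, measurable A -> pushforward nu f A = nu A.

(* Main.v *)
Require Import Defs.
From HB Require Import structures.
From mathcomp Require Import all_boot all_order all_algebra finmap.
From mathcomp Require Import zify lra.
From mathcomp Require Import all_classical all_reals all_analysis.
From mathcomp Require Import measurable_realfun.
Set Implicit Arguments.
Unset Strict Implicit.
Unset Printing Implicit Defensive.
Import Order.TTheory GRing.Theory Num.Theory.
Import numFieldNormedType.Exports.
Local Open Scope classical_set_scope.
Local Open Scope ring_scope.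

(* A leapfrog step factors as half kick, drift, half kick. Each factor is a
   shear of R^d x R^d, with inverse the shear of opposite step size, and
   preserves Lebesgue measure by Fubini and translation invariance. Conjugating
   a leapfrog step by the momentum flip reverses the sign of its step size, so
   the backward evolution is made of leapfrog steps of size - h / l_j; hence it
   inverts the forward one, and no reflection invariance of Lebesgue measure is
   needed. Finally Psi is a skew product over an involution of the countable
   set of discrete parts, so it preserves zeta by Fubini again. *)

(** * Closure properties of measure-preserving maps *)

Section measure_preserving.
Context d (T : measurableType d) (R : realType) (nu : set T -> \bar R).
Implicit Types f g : T -> T.

Lemma measure_preserving_id : measure_preserving nu id.
Proof. by split. Qed.

Lemma measure_preserving_comp f g :
  measure_preserving nu f -> measure_preserving nu g ->
  measure_preserving nu (f \o g).
Proof.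
move=> [mf nuf] [mg nug]; split; first exact: measurableT_comp.
move=> A mA; rewrite -(nuf _ mA) -[RHS](nug (f @^-1` A))//.
by rewrite -[X in measurable X]setTI; exact: mf.
Qed.

Lemma measure_preserving_iter n f :
  measure_preserving nu f -> measure_preserving nu (iter n f).
Proof.
move=> fP; elim: n => [|n IHn]; first exact: measure_preserving_id.
exact: measure_preserving_comp fP IHn.
Qed.

(** Agreement on measurable sets suffices, since preimages of measurable sets under [f] are again
    measurable. This allows the order of integration in a product measure to be exchanged. *)
Lemma measure_preserving_eq (nu' : set T -> \bar R) f :
  (forall A, measurable A -> nu A = nu' A) ->
  measure_preserving nu f -> measure_preserving nu' f.
Proof.
move=> nuE [mf nuf]; split=> // A mA.
rewrite -[RHS]nuE// -nuf// /pushforward nuE//.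
by rewrite -[X in measurable X]setTI; exact: mf.
Qed.

End measure_preserving.

(** * Change of variables, Fubini for skew products, and translations of the line *)

Section integral_measure_preserving.
Context d (T : measurableType d) (R : realType).
Variable nu : {measure set T -> \bar R}.

Lemma ge0_integral_measure_preserving (f : T -> T) (g : T -> \bar R) :
  measure_preserving nu f -> measurable_fun setT g ->
  (forall x, (0 <= g x)%E) ->
  (\int[nu]_x g (f x) = \int[nu]_x g x)%E.
Proof.
move=> [mf nuf] mg g0.
transitivity (\int[pushforward nu f]_x g x)%E.
  by rewrite ge0_integral_pushforward.
apply: eq_measure_integral => A mA _.
exact: nuf.
Qed.

End integral_measure_preserving.

Section skew_product.
Context d1 d2 (T1 : measurableType d1) (T2 : measurableType d2) (R : realType).

(** The section at [x] of the preimage of [A] is the preimage under [g x] of the section of [A] at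
    [f x]. So it has the measure of that section, and a change of variables along [f] in the outer
    integral finishes. *)
Lemma measure_preserving_skew1
    (m1 : {measure set T1 -> \bar R})
    (m2 : {sigma_finite_measure set T2 -> \bar R})
    (f : T1 -> T1) (g : T1 -> T2 -> T2) :
  measure_preserving m1 f -> (forall x, measure_preserving m2 (g x)) ->
  measurable_fun setT (fun p : T1 * T2 => g p.1 p.2) ->
  measure_preserving (product_measure1 m1 m2)
    (fun p : T1 * T2 => (f p.1, g p.1 p.2)).
Proof.
move=> fP gP mg; split.
  apply: measurable_fun_pair => //.
  by apply: measurableT_comp => //; exact: fP.1.
move=> A mA; rewrite /pushforward /product_measure1 /=.
rewrite -(ge0_integral_measure_preserving fP (g := m2 \o xsection A))//;
  last exact: measurable_fun_xsection.
apply: eq_integral => x _ /=.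
rewrite -[RHS](gP x).2; last exact: measurable_xsection.
by congr (m2 _); apply/seteqP; split=> y; rewrite /= /xsection /= !inE.
Qed.

(** Mirror image of [measure_preserving_skew1], with the second factor as base: the order that suits
    drifts, fibred over the momentum, and [Psi], fibred over the discrete part. *)
Lemma measure_preserving_skew2
    (m1 : {sigma_finite_measure set T1 -> \bar R})
    (m2 : {measure set T2 -> \bar R})
    (f : T2 -> T2) (g : T2 -> T1 -> T1) :
  measure_preserving m2 f -> (forall y, measure_preserving m1 (g y)) ->
  measurable_fun setT (fun p : T1 * T2 => g p.2 p.1) ->
  measure_preserving (product_measure2 m1 m2)
    (fun p : T1 * T2 => (g p.2 p.1, f p.2)).
Proof.
move=> fP gP mg; split.
  apply: measurable_fun_pair => //.
  by apply: measurableT_comp => //; exact: fP.1.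
move=> A mA; rewrite /pushforward /product_measure2 /=.
rewrite -(ge0_integral_measure_preserving fP (g := m1 \o ysection A))//;
  last exact: measurable_fun_ysection.
apply: eq_integral => y _ /=.
rewrite -[RHS](gP y).2; last exact: measurable_ysection.
by congr (m1 _); apply/seteqP; split=> x; rewrite /= /ysection /= !inE.
Qed.

Lemma product_measure12
    (m1 : {sigma_finite_measure set T1 -> \bar R})
    (m2 : {sigma_finite_measure set T2 -> \bar R}) (A : set (T1 * T2)) :
  measurable A -> product_measure1 m1 m2 A = product_measure2 m1 m2 A.
Proof. by apply: product_measure_unique => *; exact: product_measure2E. Qed.

End skew_product.

(** By uniqueness of Lebesgue measure it is enough that the translated measure gives half-open
    intervals their length. *)
Lemma lebesgue_measure_translation (R : realType) (c : R) :
  measure_preserving (@lebesgue_measure R) (fun x => x + c).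
Proof.
have mc : measurable_fun [set: measurableTypeR R] (fun x => x + c).
  exact: measurable_funD.
split=> // A mA; apply/esym.
apply: lebesgue_measure_unique A mA.
move=> _ [[a b] _ <-] /=.
rewrite lebesgue_measure_itv /pushforward.
have -> : (fun x : R => x + c) @^-1` `]a, b]%classic =
    `]a - c, b - c]%classic.
  by apply/seteqP; split=> x; rewrite /= !in_itv/= ltrBlDr lerBrDr.
rewrite lebesgue_measure_itv /= !lte_fin ltrD2r.
by case: ifP => // _; rewrite -!EFinB opprB addrA subrK.
Qed.

(** * Borel measurability of matrix-valued maps *)

Section borel_matrix.
Context {R : realType} {m n : nat}.

Lemma measurable_coord (i : 'I_m) (j : 'I_n) :
  measurable_fun [set: 'M[R]_(m, n)] (fun A => A i j).
Proof.
apply: (measurability _ (RGenOpens.measurableE R)).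
move=> _ [_ [a [b ->] <-]]; rewrite setTI.
apply: sub_sigma_algebra; apply: open_comp; last exact: interval_open.
by move=> A _; exact: coord_continuous.
Qed.

(** Every open set is the union of the boxes with rational endpoints inside it. There are countably
    many of these, and the preimage of each is a finite intersection of coordinate preimages. *)
Lemma measurable_mx d (T : measurableType d) (f : T -> 'M[R]_(m, n)) :
  (forall i j, measurable_fun setT (fun x => f x i j)) -> measurable_fun setT f.
Proof.
move=> mf; apply: (@measurability _ _ _ 'M[R]_(m, n) _ _ open erefl) => //.
move=> _ [U oU <-]; rewrite setTI.
pose box (q : 'M[rat * rat]_(m, n)) :=
  [set A : 'M[R]_(m, n) | forall i j,
    A i j \in `]ratr (q i j).1, ratr (q i j).2[].
have -> : f @^-1` U = \bigcup_(q in [set q | box q `<=` U]) (f @^-1` box q).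
  apply/seteqP; split=> [x Ufx|x [q qU]]; last exact: qU.
  have /nbhs_ballP[e /= e0 eU] : nbhs (f x) U by exact: open_nbhs_nbhs.
  have lo i j : exists q : rat, ratr q \in `]f x i j - e, f x i j[.
    by apply: rat_in_itvoo; rewrite gtrBl.
  have hi i j : exists q : rat, ratr q \in `]f x i j, f x i j + e[.
    by apply: rat_in_itvoo; rewrite ltrDl.
  (* Both endpoints lie within [e] of the coordinate of [f x], on either side of it, so the box
     contains [f x] and stays in the ball of radius [e]. *)
  exists (\matrix_(i, j) (projT1 (cid (lo i j)), projT1 (cid (hi i j)))) => /=.
    move=> A Abox; apply: eU; split=> // i j.
    have := Abox i j; rewrite mxE /=.
    case: cid => p /=; case: cid => q /=; rewrite !in_itv/= /ball/=.
    by rewrite ltr_norml; lra.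
  move=> i j; rewrite mxE /=.
  by case: cid => p /=; case: cid => q /=; rewrite !in_itv/=; lra.
(* The union is extended to the whole countable type of rational boxes, with the empty set at those
   not contained in [U]. *)
rewrite bigcup_mkcond; apply: countable_bigcupT_measurable => // q.
case: ifP => // _.
have -> : f @^-1` box q = \bigcap_(k in [set: 'I_m * 'I_n])
    (fun x => f x k.1 k.2) @^-1`
      `]ratr (q k.1 k.2).1, ratr (q k.1 k.2).2[%classic.
  apply/seteqP; split=> x /= fx; first by move=> [i j] _; exact: fx.
  by move=> i j; exact: (fx (i, j)).
apply: fin_bigcap_measurable => // k _.
by rewrite -[X in measurable X]setTI; apply: mf => //; exact: measurable_itv.
Qed.

Lemma continuous_measurable_fun_mx p q (f : 'M[R]_(m, n) -> 'M[R]_(p, q)) :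
  continuous f -> measurable_fun setT f.
Proof.
move=> cf.
apply: (@measurability _ _ 'M[R]_(m, n) 'M[R]_(p, q) setT f open erefl).
move=> _ [U oU <-]; rewrite setTI.
apply: sub_sigma_algebra.
by have /continuousP := cf; exact.
Qed.

End borel_matrix.

Section borel_matrix_operations.
Context {R : realType} {m n : nat} d (T : measurableType d).
Implicit Types f g : T -> 'M[R]_(m, n).

Lemma measurable_mx_coord f i j :
  measurable_fun setT f -> measurable_fun setT (fun x => f x i j).
Proof. exact: (measurableT_comp (measurable_coord i j)). Qed.

Lemma measurable_addmx f g : measurable_fun setT f -> measurable_fun setT g ->
  measurable_fun setT (fun x => f x + g x).
Proof.
move=> mf mg; apply: measurable_mx => i j.
under eq_fun do rewrite mxE.
by apply: measurable_funD; exact: measurable_mx_coord.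
Qed.

Lemma measurable_mulmx p (A : 'M[R]_(p, m)) f : measurable_fun setT f ->
  measurable_fun setT (fun x => A *m f x).
Proof.
move=> mf; apply: measurable_mx => i j.
under eq_fun do rewrite mxE.
apply: measurable_sum => k.
by apply: measurable_funM => //; exact: measurable_mx_coord.
Qed.

Lemma measurable_scalemx (a : R) f : measurable_fun setT f ->
  measurable_fun setT (fun x => a *: f x).
Proof.
move=> mf; apply: measurable_mx => i j.
under eq_fun do rewrite mxE.
by apply: measurable_funM => //; exact: measurable_mx_coord.
Qed.

End borel_matrix_operations.

(** * Sigma-finiteness of pushforwards and products *)

Section sigma_finite_measure.
Context (R : realType).

Lemma sigma_finite_measure_of d (T : measurableType d)
    (nu : {measure set T -> \bar R}) :
  sigma_finite setT nu ->
  exists nu' : {sigma_finite_measure set T -> \bar R},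
    nu = nu' :> (set T -> \bar R).
Proof.
move=> nufin.
pose sfin := isSFinite.Build _ _ _ (Measure.sort nu)
  (sfinite_measure_sigma_finite nufin).
pose fin := isSigmaFinite.Build _ _ _ (Measure.sort nu) nufin.
by exists (HB.pack_for {sigma_finite_measure set T -> \bar R}
  (Measure.sort nu) sfin fin).
Qed.

Context d1 d2 (T1 : measurableType d1) (T2 : measurableType d2).

(** A cover of [T1] by sets of finite measure is carried to [T2] by taking preimages under the left
    inverse [g]; pulling back along [f] restores it. *)
Lemma pushforward_sigma_finite (nu : {sigma_finite_measure set T1 -> \bar R})
    (f : T1 -> T2) (g : T2 -> T1) :
  measurable_fun setT f -> measurable_fun setT g -> cancel f g ->
  exists nu' : {sigma_finite_measure set T2 -> \bar R}, pushforward nu f = nu'.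
Proof.
move=> mf mg fK.
have nufin : sigma_finite setT (pushforward nu f).
  have [F FT Foo] := sigma_finiteT nu.
  exists (fun k => g @^-1` F k); first by rewrite -preimage_bigcup -FT.
  move=> k; have [mF nuF] := Foo k; split.
    by rewrite -[X in measurable X]setTI; exact: mg.
  rewrite /pushforward (_ : f @^-1` _ = F k)//.
  by apply/seteqP; split=> x /=; rewrite fK.
exact: (sigma_finite_measure_of (nu :=
  measure_function_pushforward__canonical__measure_function_Measure nu mf)).
Qed.

(* The library declares this instance, but it is shadowed by the one for
   subprobability measures and cannot be inferred. *)
Lemma product_measure1_sigma_finite
    (m1 : {sigma_finite_measure set T1 -> \bar R})
    (m2 : {sigma_finite_measure set T2 -> \bar R}) :
  exists nu : {sigma_finite_measure set (T1 * T2)%type -> \bar R},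
    product_measure1 m1 m2 = nu.
Proof.
apply: sigma_finite_measure_of.
have /sigma_finiteP[F [FT ndF Foo]] := sigma_finiteT m1.
have /sigma_finiteP[G [GT ndG Goo]] := sigma_finiteT m2.
exists (fun k => F k `*` G k).
  apply/seteqP; split=> // -[x y] _.
  have [i _ Fix] : (\bigcup_k F k) x by rewrite -FT.
  have [j _ Gjy] : (\bigcup_k G k) y by rewrite -GT.
  exists (maxn i j) => //; split => /=.
    by move: Fix; apply/subsetPset/ndF/leq_maxl.
  by move: Gjy; apply/subsetPset/ndG/leq_maxr.
move=> k; have [mF Fk] := Foo k; have [mG Gk] := Goo k.
split; first exact: measurableX.
by rewrite [ltLHS]product_measure1E// lte_mul_pinfty// ge0_fin_numE.
Qed.

End sigma_finite_measure.

(** * Lebesgue measure on column vectors *)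

Section lebesgue_cV.
Variable R : realType.

Let join n (p : measurableTypeR R * 'cV[R]_n) : 'cV[R]_n.+1 :=
  col_mx (p.1)%:M p.2.

Let measurable_join n : measurable_fun setT (@join n).
Proof.
apply: measurable_mx => i j; rewrite (ord1 j).
case: (split_ordP (i : 'I_(1 + n))) => k ->.
  rewrite (_ : (fun p => _) = fst); first exact: measurable_fst.
  by apply/funext => p; rewrite [LHS]col_mxEu (ord1 k) mxE mulr1n.
rewrite (_ : (fun p => _) =
    (fun p : measurableTypeR R * 'cV[R]_n => p.2 k 0)).
  by apply: measurable_mx_coord; exact: measurable_snd.
by apply/funext => p; rewrite [LHS]col_mxEd.
Qed.

Let join_add n p q : @join n (p.1 + q.1, p.2 + q.2) = join p + join q.
Proof. by rewrite /join /= raddfD /= -add_col_mx. Qed.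

Let split_col n (v : 'cV[R]_n.+1) : measurableTypeR R * 'cV[R]_n :=
  (usubmx (v : 'cV[R]_(1 + n)) 0 0, dsubmx (v : 'cV[R]_(1 + n))).

Let joinK n : cancel (@join n) (@split_col n).
Proof.
move=> [x v]; rewrite /split_col [X in usubmx X]/join [X in dsubmx X]/join.
by rewrite col_mxKu col_mxKd mxE mulr1n.
Qed.

Let split_colK n : cancel (@split_col n) (@join n).
Proof.
move=> v; rewrite /join /split_col /= -[RHS](@vsubmxK _ 1 n 1).
by rewrite -mx11_scalar.
Qed.

Let measurable_split_col n : measurable_fun setT (@split_col n).
Proof.
apply: measurable_fun_pair; last apply: measurable_mx => i j;
  under eq_fun do rewrite mxE; exact: measurable_coord.
Qed.

(** [lebesgue_cV] is defined as a bare set function; this identifies it with a bundled measure to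
    which the Fubini lemmas apply. *)
Lemma lebesgue_cV_sigma_finite_measure n :
  exists nu : {sigma_finite_measure set 'cV[R]_n -> \bar R},
    @lebesgue_cV R n = nu.
Proof.
elim: n => [|n [nu nuE]]; first by exists (dirac (0 : 'cV[R]_0)).
have [prod prodE] := product_measure1_sigma_finite (@lebesgue_measure R) nu.
have [nu' nu'E] :=
  pushforward_sigma_finite prod (@measurable_join n) (@measurable_split_col n)
    (@joinK n).
by exists nu'; rewrite -nu'E -prodE -nuE.
Qed.

(** Induction on the dimension: [join] is additive, so translation by [v] corresponds to translating
    the first coordinate and the remaining vector separately, a skew product. *)
Lemma lebesgue_cV_translation n (v : 'cV[R]_n) :
  measure_preserving (@lebesgue_cV R n) (fun x => x + v).
Proof.
elim: n v => [|n IHn] v.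
  rewrite (_ : (fun x => _) = id); first exact: measure_preserving_id.
  by apply/funext => x; rewrite [LHS]flatmx0 [RHS]flatmx0.
split; first by apply: measurable_addmx.
have [nu nuE] := lebesgue_cV_sigma_finite_measure n.
move=> A mA /=.
set w := split_col v.
have [mt tP] : measure_preserving (product_measure1 (@lebesgue_measure R) nu)
    (fun p => (p.1 + w.1, p.2 + w.2)).
  apply: (@measure_preserving_skew1 _ _ _ _ _ lebesgue_measure nu
    (fun x => x + w.1) (fun _ x => x + w.2)).
  - exact: lebesgue_measure_translation.
  - by move=> _; rewrite -nuE; exact: IHn.
  - by apply: measurable_addmx => //; exact: measurable_snd.
have mjA : measurable (@join n @^-1` A).
  by rewrite -[X in measurable X]setTI; exact: measurable_join.
rewrite nuE /pushforward -[RHS](tP _ mjA) /pushforward.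
congr (product_measure1 _ _ _); apply/funext => p; congr (A _).
by rewrite [RHS]join_add split_colK.
Qed.

End lebesgue_cV.

(** * The gradient of log mu *)

Section gradient_ln.
Context {R : realType} {d : nat}.
Implicit Types mu : 'cV[R]_d -> R.

Lemma gradient_ln mu x : 0 < mu x -> differentiable mu x ->
  gradient (fun y => ln (mu y)) x = (mu x)^-1 *: gradient mu x.
Proof.
move=> mu0 dmu; apply/colP => i; rewrite !mxE.
have lnE := is_derive1_ln mu0.
have dln : differentiable (@ln R) (mu x) by apply/derivable1_diffP.
rewrite deriveE; last exact: differentiable_comp.
transitivity (('d (@ln R) (mu x) \o 'd mu x) (delta_mx i 0)).
  by rewrite -diff_comp.
(* The inner derivative is a scalar multiple of 1, so linearity pulls it out of the differential of
   [ln]. *)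
rewrite /= -(deriveE _ dmu) -[X in 'd _ _ X]mulr1 linearZ /=.
by rewrite -deriveE// derive_val /= mulrC.
Qed.

Lemma measurable_gradient_ln mu : (forall x, 0 < mu x) ->
  continuously_differentiable mu ->
  measurable_fun setT (gradient (fun x => ln (mu x))).
Proof.
move=> mu0 [dmu cmu].
rewrite (_ : gradient _ = fun x => (mu x)^-1 *: gradient mu x); last first.
  by apply/funext => x; exact: gradient_ln.
apply: continuous_measurable_fun_mx => x.
have cmux : (fun y => (mu y)^-1) y @[y --> x] --> (mu x)^-1.
  exact: cvgV (lt0r_neq0 (mu0 x)) (differentiable_continuous (dmu x)).
exact: cvgZ cmux (cmu x).
Qed.

End gradient_ln.

(** * Reversibility of the leapfrog map and of the evolution *)

Section leapfrog.
Context {R : realType} {d : nat}.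
Implicit Types (z : 'cV[R]_d * 'cV[R]_d) (s c h : R) (M : 'M[R]_d).

(** For [g] the gradient of log mu and [P] the inverse of [M], [kick] and [drift] are the exact
    flows of the potential and kinetic parts of the Hamiltonian. *)
Definition kick (g : 'cV[R]_d -> 'cV[R]_d) c z := (z.1, z.2 + c *: g z.1).

Definition drift (P : 'M[R]_d) s z := (z.1 + P *m (s *: z.2), z.2).

Lemma kickK g c : cancel (kick g c) (kick g (- c)).
Proof. by move=> [x p]; rewrite /kick /= scaleNr addrK. Qed.

Lemma driftK P s : cancel (drift P s) (drift P (- s)).
Proof. by move=> [x p]; rewrite /drift /= scaleNr mulmxN addrK. Qed.

Lemma kick_flip g c z :
  momentum_flip (kick g c (momentum_flip z)) = kick g (- c) z.
Proof. by rewrite /kick /momentum_flip /= opprD opprK scaleNr. Qed.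

Lemma drift_flip P s z :
  momentum_flip (drift P s (momentum_flip z)) = drift P (- s) z.
Proof. by rewrite /drift /momentum_flip /= opprK scaleNr scalerN. Qed.

Lemma momentum_flipK : involutive (@momentum_flip R d).
Proof. by move=> [x p]; rewrite /momentum_flip /= opprK. Qed.

Variable mu : 'cV[R]_d -> R.
Let g := gradient (fun x => ln (mu x)).

Lemma leapfrogE M s z :
  leapfrog mu M s z = kick g (s / 2) (drift (invmx M) s (kick g (s / 2) z)).
Proof.
have sg : s *: (s / 2 *: g z.1) = (s ^+ 2 / 2) *: g z.1.
  by rewrite scalerA expr2 mulrA.
rewrite /kick /drift /leapfrog /= -/g.
by rewrite [s *: (_ + _)]scalerDr sg scalerDr addrA.
Qed.

(** The factorization is a palindrome, so reversing its order and inverting each factor amounts to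
    negating [s]. *)
Lemma leapfrogK M s : cancel (leapfrog mu M s) (leapfrog mu M (- s)).
Proof. by move=> z; rewrite !leapfrogE mulNr kickK driftK kickK. Qed.

Lemma leapfrog_flip M s z :
  momentum_flip (leapfrog mu M s (momentum_flip z)) = leapfrog mu M (- s) z.
Proof.
rewrite !leapfrogE mulNr -!kick_flip -!drift_flip.
by rewrite !momentum_flipK.
Qed.

Lemma substepsK M h n : cancel (substeps mu M h n) (substeps mu M (- h) n).
Proof.
(* Only the two iteration counts are generalized; the [n] in the step size [h / n%:R] stays
   fixed. *)
rewrite /substeps mulNr => z; elim: {1 3}n z => // k IHk z.
by rewrite iterSr iterS leapfrogK IHk.
Qed.

Lemma substepsNK M h n : cancel (substeps mu M (- h) n) (substeps mu M h n).
Proof. by rewrite -{2}[h]opprK; exact: substepsK. Qed.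

Lemma substeps_flip M h n z :
  momentum_flip (substeps mu M h n (momentum_flip z)) =
  substeps mu M (- h) n z.
Proof.
rewrite /substeps mulNr; elim: {1 3}n => [|k IHk]; first exact: momentum_flipK.
transitivity (leapfrog mu M (- (h / n%:R))
  (iter k (leapfrog mu M (- (h / n%:R))) z)); last by [].
by rewrite -IHk -(leapfrog_flip M (h / n%:R)) [in RHS]momentum_flipK.
Qed.

(** Flips inserted between consecutive blocks cancel, so each block is conjugated separately. *)
Lemma backward_evolution_flip M h l n z :
  momentum_flip (backward_evolution mu M h l n (momentum_flip z)) =
  backward_evolution mu M (- h) l n z.
Proof.
elim: n => [|n IHn] /=; first exact: momentum_flipK.
by rewrite -IHn -(substeps_flip M h) momentum_flipK.
Qed.

(** Peels off the block applied first, whereas the definition peels off the one applied last.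
    Inverting a composition needs both. *)
Lemma forward_evolutionSr M h l n z :
  forward_evolution mu M h l n.+1 z =
  forward_evolution mu M h (fun j => l (j + 1)) n (substeps mu M h (l 0) z).
Proof.
elim: n => [//|n IHn].
transitivity (substeps mu M h (l n.+1%:Z) (forward_evolution mu M h l n.+1 z)).
  by [].
by rewrite IHn /= -PoszD addn1.
Qed.

Lemma backward_evolutionSr M h l n z :
  backward_evolution mu M h l n.+1 z =
  backward_evolution mu M h (fun j => l (j - 1)) n
    (substeps mu M h (l (- 1)) z).
Proof.
elim: n => [//|n IHn].
transitivity (substeps mu M h (l (- n.+2%:Z))
  (backward_evolution mu M h l n.+1 z)); first by [].
by rewrite IHn /= -opprD -PoszD addn1.
Qed.

(** The shift by [n] moves the last forward block, of index [n - 1], to index -1, where the backward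
    evolution starts; the blocks then cancel from the inside out. *)
Lemma forward_evolutionK M h l n z :
  backward_evolution mu M (- h) (fun j => l (j + n%:Z)) n
    (forward_evolution mu M h l n z) = z.
Proof.
elim: n => [//|n IHn]; rewrite backward_evolutionSr /=.
rewrite (_ : -1 + n.+1%:Z = n%:Z); last by lia.
rewrite substepsK -[RHS]IHn; congr (backward_evolution _ _ _ _ _ _).
by apply/funext => j; congr (l _); lia.
Qed.

(** Here the last backward block, of index [- n], is moved to index 0, where the forward evolution
    starts. *)
Lemma backward_evolutionK M h l n z :
  forward_evolution mu M h (fun j => l (j - n%:Z)) n
    (backward_evolution mu M (- h) l n z) = z.
Proof.
elim: n => [//|n IHn]; rewrite forward_evolutionSr /=.
rewrite sub0r substepsNK -[RHS]IHn; congr (forward_evolution _ _ _ _ _ _).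
by apply/funext => j; congr (l _); lia.
Qed.

Lemma evolution_Negz M h l n z :
  evolution mu M h l (Negz n) z = backward_evolution mu M (- h) l n.+1 z.
Proof. exact: backward_evolution_flip. Qed.

Lemma evolutionK M h l i z :
  evolution mu M h (fun j => l (j + i)) (- i) (evolution mu M h l i z) = z.
Proof.
(* Negation exchanges the constructors [Posz] and [Negz] except at 0, which is treated apart. *)
case: i => [[|n]|n]; first by rewrite oppr0.
  by rewrite -NegzE evolution_Negz; exact: forward_evolutionK.
by rewrite evolution_Negz NegzE opprK; exact: backward_evolutionK.
Qed.

End leapfrog.

(** * Volume preservation by the evolution *)

Section leapfrog_measure.
Context {R : realType} {d : nat}.
Variables (mu : 'cV[R]_d -> R) (M : 'M[R]_d).
Hypotheses (mu_gt0 : forall x, 0 < mu x)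
  (mu_C1 : continuously_differentiable mu).

Let vol := product_measure1 (@lebesgue_cV R d) (@lebesgue_cV R d).

Lemma kick_measure_preserving g c : measurable_fun setT g ->
  measure_preserving vol (kick g c).
Proof.
move=> mg; have [lam lamE] := lebesgue_cV_sigma_finite_measure R d.
rewrite /vol lamE.
apply: (@measure_preserving_skew1 _ _ _ _ _ lam lam id
  (fun x p => p + c *: g x)).
- exact: measure_preserving_id.
- by move=> x; rewrite -lamE; exact: lebesgue_cV_translation.
- apply: measurable_addmx; first exact: measurable_snd.
  apply: measurable_scalemx; apply: measurableT_comp mg _.
  exact: measurable_fst.
Qed.

(** At fixed momentum a drift translates the position, so the position has to be integrated first;
    hence the passage to [product_measure2]. *)
Lemma drift_measure_preserving P s : measure_preserving vol (drift P s).
Proof.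
have [lam lamE] := lebesgue_cV_sigma_finite_measure R d.
rewrite /vol lamE; apply: measure_preserving_eq => [A mA|].
  by apply/esym; exact: product_measure12.
apply: (@measure_preserving_skew2 _ _ _ _ _ lam lam id
  (fun p x => x + P *m (s *: p))).
- exact: measure_preserving_id.
- by move=> x; rewrite -lamE; exact: lebesgue_cV_translation.
- apply: measurable_addmx; first exact: measurable_fst.
  by apply: measurable_mulmx; apply: measurable_scalemx; exact: measurable_snd.
Qed.

Lemma leapfrog_measure_preserving s : measure_preserving vol (leapfrog mu M s).
Proof.
have mg := measurable_gradient_ln mu_gt0 mu_C1.
rewrite (funext (leapfrogE mu M s)).
apply: (measure_preserving_comp (kick_measure_preserving _ mg)).
apply: (measure_preserving_comp (drift_measure_preserving _ _)).
exact: kick_measure_preserving.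
Qed.

Lemma evolution_measure_preserving h l i :
  measure_preserving vol (evolution mu M h l i).
Proof.
(* The step size [k] is arbitrary because the backward evolution uses [- h]. *)
have subP k n : measure_preserving vol (substeps mu M k n).
  by apply: measure_preserving_iter; exact: leapfrog_measure_preserving.
case: i => n.
  elim: n => [|n IHn]; first exact: measure_preserving_id.
  exact: measure_preserving_comp (subP _ _) IHn.
rewrite (funext (evolution_Negz mu M h l n)).
elim: n.+1 => [|k IHk]; first exact: measure_preserving_id.
exact: measure_preserving_comp (subP _ _) IHk.
Qed.

End leapfrog_measure.

(** * The discrete component, and the assembly of [Psi] *)

Lemma discrete_mapK : involutive discrete_map.
Proof.
move=> k; apply: val_inj; rewrite /= /discrete_map /discrete_m /discrete_b
  /discrete_i /discrete_l /=.
case: (discrete_val k) => [[[m b] l] i] /=.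
rewrite opprK subrK; congr (_, _, _, _).
by apply/fsfunP => j; rewrite !shift_familyE addrNK.
Qed.

(** For an involution preimages are images, and injectivity preserves cardinality. *)
Lemma counting_involutive (T : choiceType) (R : realType) (f : T -> T)
    (A : set T) :
  involutive f -> counting (f @^-1` A) = counting A :> \bar R.
Proof.
move=> fK; have -> : f @^-1` A = f @` A.
  by apply/seteqP; split=> [x Afx|_ [x Ax <-]]; [exists (f x)|rewrite /= fK].
rewrite /counting.
have [Afin|Ainf] := pselect (finite_set A); last first.
  (* If the image of [A] were finite, applying [f] once more would make [A] finite. *)
  rewrite !asboolF// => /(finite_image f); rewrite image_comp.
  by rewrite (_ : f \o f = id) ?image_id//; apply/funext => x /=; rewrite fK.
have fAfin : finite_set (f @` A) by exact: finite_image.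
by rewrite !asboolT// fset_set_image// card_imfset//; exact: inv_inj.
Qed.

(** The preimage of a measurable set is a union of rectangles, one for each of the countably many
    discrete parts. *)
Lemma measurable_fun_prod_discrete d1 d3 (T1 : measurableType d1)
    (T3 : measurableType d3) (g : discrete_part -> T1 -> T3) :
  (forall k, measurable_fun setT (g k)) ->
  measurable_fun [set: T1 * discrete_part] (fun p => g p.2 p.1).
Proof.
move=> mg _ A mA; rewrite setTI.
have -> : (fun p => g p.2 p.1) @^-1` A = \bigcup_k (g k @^-1` A `*` [set k]).
  apply/seteqP; split=> [[x k] Agx|[x k] [_ _ [/= Agx ->]]//].
  by exists k.
apply: countable_bigcupT_measurable => // k.
apply: measurableX => //.
by rewrite -[X in measurable X]setTI; exact: mg.
Qed.

Theorem lemma2 (R : realType) (d : nat) (mu : 'cV[R]_d -> R) (M : 'M[R]_d)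
    (h : R)
    (mu_gt0 : forall x, 0 < mu x)
    (mu_C1 : continuously_differentiable mu)
    (M_sym : M^T = M)
    (M_posdef : positive_definite M)
    (h_gt0 : 0 < h) :
  involutive (@Psi R d mu M h) /\
  measure_preserving (@zeta R d) (@Psi R d mu M h).
Proof.
split=> [[z k]|].
  rewrite /Psi /= discrete_mapK; congr (_, _).
  rewrite -[RHS](evolutionK mu M h (discrete_l k) (discrete_i k)).
  congr (evolution _ _ _ _ _ _).
  (* The family stored by [discrete_map] is pointwise the shifted family of [evolutionK]. *)
  by apply/funext => j; rewrite /discrete_l /= shift_familyE.
have [lam lamE] := lebesgue_cV_sigma_finite_measure R d.
have [vol volE] := product_measure1_sigma_finite lam lam.
rewrite /zeta lamE volE.
apply: (@measure_preserving_skew2 _ _ _ _ _ vol counting discrete_map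
  (fun k => evolution mu M h (discrete_l k) (discrete_i k))).
- by split=> // A _; exact: counting_involutive discrete_mapK.
- by move=> k; rewrite -volE -lamE; exact: evolution_measure_preserving.
- apply: (measurable_fun_prod_discrete
    (g := fun k => evolution mu M h (discrete_l k) (discrete_i k))) => k.
  by have [] := evolution_measure_preserving M mu_gt0 mu_C1 h
    (discrete_l k) (discrete_i k).
Qed.
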